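(* Let $G$ be an abelian group with at least one finite nontrivial proper subgroup. Let $n$ be an integer such that $n_0(G) \leq n < |G|$. Then there exist subsets $A, B \subseteq G$ such that $1 \notin B$, $|A| = |B| = n$, and $(A,B)$ is an unmatchable pair if and only if there is a subgroup $H$ of $G$ with $|H| \leq n$ and $|H| \nmid (n+1)$.
   Context: Groups are written multiplicatively, with identity $1$. For nonempty finite subsets $A,B$ of an abelian group $G$ with $|A|=|B|$, a matching from $A$ to $B$ is a bijection $f:A\to B$ such that $af(a)\notin A$ for all $a\in A$. The pair $(A,B)$ is matchable if at least one matching from $A$ to $B$ exists, and unmatchable otherwise. For any group $G$ having at least one subgroup $H$ with $\{1\}\subsetneq H\subsetneq G$ and $|H|<\infty$, $n_0(G)$ denotes the minimum of $|H|$ over all such subgroups $H$. The group $G$ may be infinite, in which case the condition $n<|G|$ holds for every integer $n$. *)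

(* Defs.v *)
From mathcomp Require Import all_boot finmap.
From mathcomp Require Import boolp classical_sets cardinality.

Set Implicit Arguments.
Unset Strict Implicit.
Unset Printing Implicit Defensive.

Local Open Scope group_scope.
Local Open Scope fset_scope.
Local Open Scope classical_set_scope.

Definition abelian_group (G : groupType) : Prop := forall x y : G, commute x y.

Definition is_matching (G : groupType) (A B : {fset G}) (f : A -> B) : Prop :=
  bijective f /\ forall a : A, val a * val (f a) \notin A.

Definition matchable (G : groupType) (A B : {fset G}) : Prop :=
  exists f : A -> B, is_matching f.

Definition finite_nontrivial_proper_subgroup (G : groupType) (H : {fset G}) : Prop :=
  [/\ group_closed [in H], ([fset 1] `<` H)%fset & [set` H] `<` [set: G]].

Definition has_finite_nontrivial_proper_subgroup (G : groupType) : Prop :=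
  exists H : {fset G}, finite_nontrivial_proper_subgroup H.

Definition is_ntp_order (G : groupType) (m : nat) : bool :=
  `[< exists2 H : {fset G}, finite_nontrivial_proper_subgroup H & #|` H|%fset = m >].

Fact ex_ntp_order (G : groupType) :
  has_finite_nontrivial_proper_subgroup G -> exists m, is_ntp_order G m.
Proof. by case=> H sH; exists #|` H|%fset; apply/asboolP; exists H. Qed.

Definition n0 (G : groupType) (hG : has_finite_nontrivial_proper_subgroup G) : nat :=
  ex_minn (ex_ntp_order hG).

(* n < |G|, which holds for every n when G is infinite; fset_set returns the
   empty set on infinite sets, hence the guard. *)
Definition lt_group_order (n : nat) (G : groupType) : Prop :=
  finite_set [set: G] -> (n < #|` fset_set [set: G]|%fset)%N.

(* Main.v *)
Require Import Defs.
From mathcomp Require Import boolp classical_sets cardinality.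
From mathcomp Require Import all_boot finmap.
From mathcomp Require Import zify.

(** Suppose [|H|] does not divide [n + 1], and write [n = q|H| + r], so that
    [r < |H| - 1].  Let [A] consist of [q] cosets of [H] and [r] elements of
    another one, and let [B] contain [H \ 1]: the [|H| - 1] elements of [H \ 1]
    can only be matched with the [r] elements of the incomplete coset.

    Conversely, if [(A, B)] is unmatchable, Hall's theorem gives [S] in [A] and
    [V] containing [1] with [SV] in [A] and [|S| + |V| >= n + 2].  Kneser's
    theorem gives a finite subgroup [H] stabilising [SV] with
    [|SV| >= |S| + |V| - |H|].  If [|H|] divides [n + 1], then the multiple [|SV|]
    of [|H|], being at most [n], is at most [n + 1 - |H|], a contradiction.

    For Kneser's theorem, the sets [C] such that [|C| + |H| >= N] for some finite
    subgroup [H] stabilising [C] are closed under union, and the e-transform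
    produces such a set inside [AB] around each element of [AB], with
    [N = |A| + |B|]. *)

Set Implicit Arguments.
Unset Strict Implicit.
Unset Printing Implicit Defensive.

(** * Hall's marriage theorem *)

Lemma hall_marriage (T1 T2 : finType) (F : T1 -> {set T2}) :
  (forall S : {set T1}, #|S| <= #|\bigcup_(x in S) F x|) ->
  exists2 f : T1 -> T2, injective f & forall x, f x \in F x.
Proof.
(* The sets [F x] are shrunk, by induction on their total size, until all are singletons. *)
have [m] := ubnP (\sum_x #|F x|); elim: m => // m IHm in F *.
move=> lem hallF.
have F_gt0 x : 0 < #|F x|.
  by have := hallF [set x]%SET; rewrite cards1 big_set1.
have [/forallP F1|] := boolP [forall x, #|F x| <= 1].
  have sing x : exists y, F x == [set y]%SET.
    have /cards1P[y ->] : #|F x| == 1 by rewrite eqn_leq F1 F_gt0.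
    by exists y.
  exists (fun x => xchoose (sing x)) => [x y|x]; last first.
    by rewrite {2}(eqP (xchooseP (sing x))) set11.
  (* Two indices sharing a singleton would violate Hall's condition on that pair. *)
  move=> exy; apply: contraTeq (hallF [set x; y]%SET) => nxy.
  rewrite cards2 nxy (big_setD1 x) ?set21 //= setU1K ?inE // big_set1.
  rewrite (eqP (xchooseP (sing x))) (eqP (xchooseP (sing y))) exy.
  by rewrite setUid cards1.
case/forallPn=> x; rewrite -ltnNge => /card_gt1P[y1 [y2 [y1x y2x ny]]].
(* Rado: deleting either [y1] or [y2] from [F x] keeps Hall's condition, by
   submodularity of [S |-> #|F(S)|]. *)
pose F' y z := if z == x then F x :\ y else F z.
have sumF' y : y \in F x -> \sum_z #|F' y z| < m.
  move=> yx; rewrite -ltnS; apply: leq_trans lem.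
  rewrite ltnS (bigD1 x) //= [ltnRHS](bigD1 x) //= /F' eqxx.
  rewrite (eq_bigr (fun z => #|F z|)); last by move=> z /negPf->.
  by rewrite ltn_add2r [ltnRHS](cardsD1 y) yx.
have F'sub y z : F' y z \subset F z.
  by rewrite /F'; case: eqP => // ->; rewrite subsetDl.
suff [y yx hallF'] : exists2 y, y \in F x &
    forall S : {set T1}, #|S| <= #|\bigcup_(z in S) F' y z|.
  have [f inj_f fF] := IHm _ (sumF' y yx) hallF'.
  by exists f => // z; apply: subsetP (F'sub y z) _ (fF z).
have [/forallP h1|] :=
    boolP [forall S : {set T1}, #|S| <= #|\bigcup_(z in S) F' y1 z|].
  by exists y1.
have [/forallP h2|] :=
    boolP [forall S : {set T1}, #|S| <= #|\bigcup_(z in S) F' y2 z|].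
  by exists y2.
case/forallPn=> S2; rewrite -ltnNge => lt2.
case/forallPn=> S1; rewrite -ltnNge => lt1; exfalso.
have F'E y (S : {set T1}) : x \notin S ->
    \bigcup_(z in S) F' y z = \bigcup_(z in S) F z.
  move=> xS; apply: eq_bigr => z zS; rewrite /F'.
  by case: eqP zS xS => // -> ->.
have xS y (S : {set T1}) : #|\bigcup_(z in S) F' y z| < #|S| -> x \in S.
  by apply: contraLR => /F'E->; rewrite -leqNgt.
have split y (S : {set T1}) : x \in S ->
    \bigcup_(z in S) F' y z = (F x :\ y) :|: \bigcup_(z in S :\ x) F z.
  by move=> xS'; rewrite (big_setD1 x) //= {1}/F' eqxx F'E // setD11.
have x1 := xS _ _ lt1; have x2 := xS _ _ lt2.
move: lt1 lt2; rewrite !split // (cardsD1 x S1) (cardsD1 x S2) x1 x2.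
set U1 := _ :|: _; set U2 := _ :|: _ => lt1 lt2.
(* As [y1] and [y2] differ, the two truncations of [F x] together recover all of it. *)
have subU : (F x :|: \bigcup_(z in (S1 :\ x) :|: (S2 :\ x)) F z)
    \subset U1 :|: U2.
  rewrite bigcup_setU /U1 /U2; apply/subsetP => z.
  rewrite !inE => /or3P[zx|->|->]; rewrite ?orbT //.
  by rewrite zx !andbT; have [->|//] := eqVneq z y1; rewrite ny !orbT.
have subI : \bigcup_(z in (S1 :\ x) :&: (S2 :\ x)) F z \subset U1 :&: U2.
  apply/bigcupsP => z /setIP[z1 z2]; rewrite subsetI.
  by apply/andP; split; apply: subset_trans (subsetUr _ _);
    apply: (bigcup_sup z).
have eU : \bigcup_(z in x |: ((S1 :\ x) :|: (S2 :\ x))) F z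
    = F x :|: \bigcup_(z in (S1 :\ x) :|: (S2 :\ x)) F z.
  by rewrite bigcup_setU big_set1.
(* Hall's condition on these two sets makes [#|U1| + #|U2|] at least [#|S1 :\ x| + #|S2 :\ x| + 1],
   one more than [lt1] and [lt2] allow. *)
have := hallF (x |: ((S1 :\ x) :|: (S2 :\ x))).
rewrite eU cardsU1 !inE eqxx /= => le1.
have := hallF ((S1 :\ x) :&: (S2 :\ x)).
have := cardsUI U1 U2; have := cardsUI (S1 :\ x) (S2 :\ x).
have := subset_leq_card subU; have := subset_leq_card subI.
lia.
Qed.

Section Kneser.
Local Open Scope fset_scope.
Local Open Scope group_scope.

Lemma leq_mul_card_fset (T1 T2 T3 T4 : choiceType) (A : {fset T1})
    (B : {fset T2}) (C : {fset T3}) (D : {fset T4}) (f : T1 -> T2 -> T3)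
    (g : T1 -> T2 -> T4) :
  (forall a b, a \in A -> b \in B -> (f a b \in C) && (g a b \in D)) ->
  (forall a b a' b', a \in A -> b \in B -> a' \in A -> b' \in B ->
     f a b = f a' b' -> g a b = g a' b' -> a = a' /\ b = b') ->
  (#|` A| * #|` B| <= #|` C| * #|` D|)%N.
Proof.
move=> fgP fg_inj.
have := @allpairs_uniq _ _ _ (fun a b => (f a b, g a b)) A B (fset_uniq A) (fset_uniq B).
rewrite -(size_allpairs (fun a b => (f a b, g a b))) => /(_ _)/uniq_leq_size leAB.
rewrite -(size_allpairs pair C D); apply: leAB => [[a b] [a' b']|].
  move=> /allpairsP[[x y] /= [xA yB [-> ->]]] /allpairsP[[x' y'] /= [xA' yB' [-> ->]]].
  by case=> ef eg; have [-> ->] := fg_inj _ _ _ _ xA yB xA' yB' ef eg.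
move=> _ /allpairsP[[x y] /= [xA yB ->]].
have /andP[fC gD] := fgP _ _ xA yB.
by apply/allpairsP; exists (f x y, g x y).
Qed.

(** * Finite subgroups and the sets they stabilise *)

Section Subgroups.
Variable G : groupType.
Implicit Types (A B C D H K L R : {fset G}) (a b c h x y z : G).

Definition stable H C := forall c h, c \in C -> h \in H -> c * h \in C.

Lemma stable_mulr H C c h :
  group_closed [in H] -> stable H C -> h \in H -> (c * h \in C) = (c \in C).
Proof.
move=> gH sHC hH; apply/idP/idP => [ch|]; last by move=> cC; apply: sHC.
by rewrite -(mulgK h c); apply: sHC (group_closedV gH hH).
Qed.

Lemma group_closed_stable H : group_closed [in H] -> stable H H.
Proof. by move=> gH c h; apply: (group_closedM gH). Qed.

Lemma group_closedI H K :
  group_closed [in H] -> group_closed [in K] -> group_closed [in H `&` K].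
Proof.
move=> [H1 HD] [K1 KD]; split; first by rewrite inE H1 K1.
by move=> x y /fsetIP[xH xK] /fsetIP[yH yK]; rewrite inE HD ?KD.
Qed.

Lemma stableU H C D : stable H C -> stable H D -> stable H (C `|` D).
Proof.
move=> sC sD c h /fsetUP[cC|cD] hH; rewrite inE.
  by rewrite sC.
by rewrite sD ?orbT.
Qed.

Lemma stable_sub H K C : K `<=` H -> stable H C -> stable K C.
Proof. by move=> /fsubsetP sKH sC c h cC /sKH; apply: sC. Qed.

Definition lcosetf c H := [fset c * h | h in H].

Lemma card_lcosetf c H : #|` lcosetf c H| = #|` H|.
Proof. by rewrite card_imfset //; apply: mulgI. Qed.

Lemma lcosetf_sub H C c : stable H C -> c \in C -> lcosetf c H `<=` C.
Proof. by move=> sC cC; apply/fsubsetP => _ /imfsetP[h /= hH ->]; apply: sC. Qed.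

Lemma stable_lcosetf H C c : stable H C -> stable H (lcosetf c C).
Proof.
move=> sC _ h /imfsetP[x /= xC ->] hH; rewrite -mulgA.
by apply: in_imfset; apply: sC.
Qed.

Lemma stableDlcoset H C c :
  group_closed [in H] -> stable H C -> stable H (C `\` lcosetf c H).
Proof.
move=> gH sC x h; rewrite !inE => /andP[xc xC] hH; rewrite sC // andbT.
by rewrite (stable_mulr _ gH) //; apply/stable_lcosetf/group_closed_stable.
Qed.

(** [C] is a disjoint union of cosets of [H], removed here one at a time. *)
Lemma stable_dvd H C :
  group_closed [in H] -> stable H C -> (#|` H| %| #|` C|)%N.
Proof.
move=> gH; have [n] := ubnP #|` C|; elim: n C => // n IHn C ltCn sC.
have [->|/fset0Pn[c cC]] := eqVneq C fset0; first by rewrite cardfs0 dvdn0.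
have sub := lcosetf_sub sC cC.
rewrite -(cardfsID (lcosetf c H) C) (fsetIidPr sub) card_lcosetf.
rewrite dvdn_addr // IHn //; last exact: stableDlcoset.
rewrite cardfsDS // card_lcosetf.
have := fsubset_leq_card sub; rewrite card_lcosetf.
have : (0 < #|` H|)%N by rewrite cardfs_gt0; apply/fset0Pn; exists 1; case: gH.
by lia.
Qed.

(** Two factorisations [c * l * r = c * l' * r'] differ by [l'^-1 * l = r' / r], which lies in both
    subgroups. Recording this discrepancy from a chosen factorisation makes the count injective. *)
Lemma card_grid H1 H2 L R D c :
  group_closed [in H1] -> group_closed [in H2] -> L `<=` H1 -> R `<=` H2 ->
  (forall l r, l \in L -> r \in R -> c * l * r \in D) ->
  (#|` L| * #|` R| <= #|` H1 `&` H2| * #|` D|)%N.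
Proof.
move=> gH1 gH2 /fsubsetP sL /fsubsetP sR LRD.
pose P y := fun l => l \in L /\ exists2 r, r \in R & y = c * l * r.
(* [g y] is a chosen left factor of [y]; the default [1] is taken only outside [c L R]. *)
pose g y := xget 1 (P y).
have gP l r : l \in L -> r \in R -> P (c * l * r) (g (c * l * r)).
  by move=> lL rR; apply: (@xgetPex _ 1 (P _)); exists l; split=> //; exists r.
apply: (leq_mul_card_fset (f := fun l r => (g (c * l * r))^-1 * l)
                         (g := fun l r => c * l * r)).
  move=> l r lL rR; rewrite LRD // andbT.
  have [gL [r' r'R]] := gP _ _ lL rR; set l' := g _ in gL *.
  rewrite -2!mulgA => /mulgI e; rewrite inE; apply/andP; split.
    by apply: (group_closedM gH1); [apply: (group_closedV gH1)|]; apply: sL.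
  suff -> : l'^-1 * l = r' / r by case: gH2 => _; apply; apply: sR.
  by apply: (mulgI l'); rewrite mulVKg mulgA -e mulgK.
move=> l r l' r' _ _ _ _ eg ec; move: eg ec; rewrite /= => eg ec.
by move: eg; rewrite ec => /mulgI el; move: ec; rewrite el => /mulgI.
Qed.

End Subgroups.

(** In [card_stableD], [k] is the size of the intersection of [H1] and [H2], [l + l'] and [r + r']
    are the sizes of [H1] and [H2], and [x], [y] those of [C2 \ C1] and [C1 \ C2]. If [l'] and [r']
    are nonzero and the first two conclusions fail, the first product bound forces [r < l'], which
    contradicts the second. *)
Lemma grid_arith k l r l' r' x y : (0 < k)%N -> (k <= l)%N -> (k <= r)%N ->
  l' = 0%N \/ (k <= l')%N -> r' = 0%N \/ (k <= r')%N ->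
  (l * r <= k * x)%N -> (l' * r' <= k * y)%N ->
  [\/ (l + l' <= x + k)%N, (r + r' <= y + k)%N | (r + r' <= x)%N].
Proof.
move=> k0 kl kr [->|kl'].
  move=> _ lr _; constructor 1; suff : (k * l <= k * x)%N by rewrite leq_pmul2l //; lia.
  by nia.
case=> [->|kr'] lr lr'.
  by constructor 3; rewrite addn0 -(leq_pmul2l k0); nia.
have [|lt1] := leqP (l + l')%N (x + k)%N; first by constructor 1.
have [|lt2] := leqP (r + r')%N (y + k)%N; first by constructor 2.
exfalso.
have h1 : (r < l')%N.
  rewrite ltnNge; apply/negP => lr1.
  have : (k * x < k * (l + l' - k))%N by rewrite ltn_pmul2l //; lia.
  have : (l * (r - k) >= k * (l' - k))%N by apply: leq_mul; lia.
  by nia.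
have : (k * y < k * (r + r' - k))%N by rewrite ltn_pmul2l //; lia.
have : (r' * (l' - k) >= k * (r - k))%N by apply: leq_mul; lia.
by nia.
Qed.

(** * Unions, the e-transform and Kneser's theorem in abelian groups *)

Section Abelian.
Variables (G : groupType) (abG : abelian_group G).
Implicit Types (A B C D H K L R : {fset G}) (a b c h x y z : G).

Lemma mulg_rotr x y z : x * y * z = x * z * y.
Proof. by rewrite -!mulgA (abG y). Qed.

(* For [c] in [C2 \ C1], let [L] be the [l] in [H1] with [c l] in [C2], and [R] the
   [r] in [H2] with [c r] not in [C1].  Then [c L R] lies in [C2 \ C1] and
   [c (H1 \ L) (H2 \ R)] in [C1 \ C2]. *)
Lemma card_stableD H1 H2 C1 C2 :
  group_closed [in H1] -> group_closed [in H2] ->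
  stable H1 C1 -> stable H2 C2 -> ~~ (C2 `<=` C1) ->
  let k := #|` H1 `&` H2| in
  [\/ (#|` H1| <= #|` C2 `\` C1| + k)%N, (#|` H2| <= #|` C1 `\` C2| + k)%N
    | (#|` H2| <= #|` C2 `\` C1|)%N].
Proof.
move=> gH1 gH2 s1 s2 /fsubsetPn[c c2 c1] k.
have gK := group_closedI gH1 gH2.
pose L := [fset h in H1 | c * h \in C2].
pose R := [fset h in H2 | c * h \notin C1].
have sL : L `<=` H1 by apply/fsubsetP => h; rewrite !inE => /andP[].
have sR : R `<=` H2 by apply/fsubsetP => h; rewrite !inE => /andP[].
have kH x : x \in H1 `&` H2 -> (x \in H1) /\ (x \in H2) by move/fsetIP.
rewrite -(cardfsID L H1) -(cardfsID R H2) (fsetIidPr sL) (fsetIidPr sR).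
(* A nonempty set stable under the intersection contains one of its cosets. *)
have leK D : D = fset0 \/ (exists2 z, z \in D & stable (H1 `&` H2) D) ->
    #|` D| = 0%N \/ (k <= #|` D|)%N.
  move=> [->|[z zD sD]]; first by left; rewrite cardfs0.
  by right; rewrite /k -(card_lcosetf z (_ `&` _)) fsubset_leq_card // lcosetf_sub.
have sK1 := stable_sub (fsubsetIl H1 H2); have sK2 := stable_sub (fsubsetIr H1 H2).
apply: grid_arith.
- by rewrite cardfs_gt0; apply/fset0Pn; exists 1; case: gK.
- apply/fsubset_leq_card/fsubsetP => x /kH[x1 x2].
  by rewrite !inE x1 s2.
- apply/fsubset_leq_card/fsubsetP => x /kH[x1 x2].
  by rewrite !inE x2 (stable_mulr _ gH1 s1).
- apply: leK; have [->|/fset0Pn[z zD]] := eqVneq (H1 `\` L) fset0; [by left|right].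
  exists z => // y x; rewrite !inE => /andP[]; case yH: (y \in H1) => //= yC _.
  move=> /andP[x1 x2]; rewrite (group_closedM gH1) //= andbT.
  by rewrite mulgA (stable_mulr _ gH2 s2).
- apply: leK; have [->|/fset0Pn[z zD]] := eqVneq (H2 `\` R) fset0; [by left|right].
  exists z => // y x; rewrite !inE => /andP[]; case yH: (y \in H2) => //= yC _.
  move=> /andP[x1 x2]; rewrite (group_closedM gH2) //= andbT.
  by rewrite mulgA (stable_mulr _ gH1 s1).
- apply: (card_grid (c := c)) => // l r; rewrite !inE => /andP[l1 l2] /andP[r1 r2].
  by rewrite s2 // andbT mulg_rotr (stable_mulr _ gH1 s1).
- apply: (card_grid (c := c)) => //; try exact: fsubsetDl.
  move=> l r; rewrite !inE => /andP[]; case lH: (l \in H1) => //= l2 _.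
  case/andP; case rH: (r \in H2) => //=; rewrite negbK => r1 _.
  by rewrite (stable_mulr _ gH2 s2) // l2 mulg_rotr s1.
Qed.

Definition kneser_bound n C := exists H,
  [/\ group_closed [in H], stable H C & (n <= #|` C| + #|` H|)%N].

Lemma kneser_boundU n C1 C2 :
  kneser_bound n C1 -> kneser_bound n C2 -> kneser_bound n (C1 `|` C2).
Proof.
move=> [H1 [g1 s1 n1]] [H2 [g2 s2 n2]].
have [s21|n21] := boolP (C2 `<=` C1).
  by rewrite (fsetUidPl _ _ s21); exists H1.
have [s12|n12] := boolP (C1 `<=` C2).
  by rewrite (fsetUidPr _ _ s12); exists H2.
exists (H1 `&` H2); split; first exact: group_closedI.
  apply: stableU; first exact: stable_sub (fsubsetIl _ _) s1.
  exact: stable_sub (fsubsetIr _ _) s2.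
(* Either of the first two alternatives, in either call, bounds the union. If both calls give the
   third, adding the bounds for [C1] and [C2] shows that twice the size of the union is at least
   [2n]. *)
have := card_stableD g1 g2 s1 s2 n21; have := card_stableD g2 g1 s2 s1 n12.
cbv zeta; rewrite (fsetIC H2).
have := cardfsID C1 (C1 `|` C2); have := cardfsID C2 (C1 `|` C2).
rewrite (fsetIidPr (fsubsetUl _ _)) (fsetIidPr (fsubsetUr _ _)).
rewrite !fsetDUl !fsetDv fset0U fsetU0.
by move=> e2 e1 [] h2 [] h1; lia.
Qed.

Definition mulf A B := [fset a * b | a in A, b in B].

Lemma mem_mulf A B a b : a \in A -> b \in B -> a * b \in mulf A B.
Proof. by move=> aA bB; apply/imfset2P; exists a => //; exists b. Qed.

Lemma mulfP A B z :
  reflect (exists a b, [/\ a \in A, b \in B & z = a * b]) (z \in mulf A B).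
Proof.
apply/(iffP idP) => [/imfset2P[a /= aA [b /= bB ->]]|[a [b [aA bB ->]]]].
  by exists a, b.
exact: mem_mulf.
Qed.

(* When [1] is in [A], the stabiliser of [A] is contained in [A]. *)
Definition stabf A := [fset h in A | [forall a : A, val a * h \in A]].

Lemma stabfP A h :
  1 \in A -> reflect (forall a, a \in A -> a * h \in A) (h \in stabf A).
Proof.
move=> A1; rewrite !inE; apply: (iffP andP) => [[_ /forallP hA] a aA|hA].
  exact: hA [` aA].
by split; [rewrite -[h]mul1g hA | apply/forallP => a; apply: hA (valP a)].
Qed.

Lemma group_closed_stabf A : 1 \in A -> group_closed [in stabf A].
Proof.
move=> A1; split; first by apply/(stabfP _ A1) => a; rewrite mulg1.
move=> x y /(stabfP _ A1) xA /(stabfP _ A1) yA; apply/(stabfP _ A1) => a /xA.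
rewrite mulgA; move: (a * x) => {xA}a aA.
(* Right multiplication by [y] is injective from the finite set [A] to itself, hence onto, so
   division by [y] preserves [A] too. *)
have /fsubset_cardP : #|` [fset b * y | b in A]| = #|` A|.
  by rewrite card_imfset //; apply: mulIg.
have /[swap]/[apply] eA : [fset b * y | b in A] `<=` A.
  by apply/fsubsetP => _ /imfsetP[b /= /yA ? ->].
by move: aA; rewrite -eA => /imfsetP[b /= bA ->]; rewrite mulgK.
Qed.

(** While some [e] in [A] has [eB] not inside [A], replace [A] by its union with [eB], and [B] by
    its intersection with [e^-1 A]. The sizes keep their sum, [1] stays in both sets, [B] shrinks
    and the product stays inside [AB]. *)
Lemma kneser_bound_e_transform A B : 1 \in A -> 1 \in B ->
  exists C, [/\ 1 \in C, C `<=` mulf A B & kneser_bound (#|` A| + #|` B|) C].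
Proof.
have [n] := ubnP #|` B|; elim: n A B => // n IHn A B ltBn A1 B1.
have [/fsubsetP AB|] := boolP (mulf A B `<=` A).
  (* [B] is contained in the stabiliser of [A]. *)
  exists A; split=> //.
    by apply/fsubsetP => a aA; rewrite -[a]mulg1 mem_mulf.
  exists (stabf A); split; first exact: group_closed_stabf.
    by move=> c h cA /(stabfP _ A1); apply.
  rewrite leq_add2l; apply/fsubset_leq_card/fsubsetP => b bB.
  by apply/(stabfP _ A1) => a aA; apply/AB/mem_mulf.
case/fsubsetPn => _ /mulfP[e [b [eA bB ->]]] ebA.
pose eB := lcosetf e B.
pose A' := A `|` eB; pose B' := [fset x in B | e * x \in A].
have card' : (#|` A'| + #|` B'| = #|` A| + #|` B|)%N.
  rewrite -(card_lcosetf e B) -(card_lcosetf e B') -/eB -(cardfsUI A eB).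
  congr (_ + _)%N; congr (#|` _|); apply/fsetP => z; rewrite inE.
  apply/imfsetP/andP => [[x /=]|[zA /imfsetP[x /= xB zE]]].
    by rewrite !inE => /andP[xB exA] ->; split=> //; apply: in_imfset.
  by exists x; rewrite // !inE xB -zE.
have ltB' : (#|` B'| < n)%N.
  rewrite -ltnS; apply: leq_trans ltBn; rewrite ltnS; apply: fproper_ltn_card.
  rewrite fproperE; apply/andP; split.
    by apply/fsubsetP => x; rewrite !inE => /andP[].
  by apply/fsubsetPn; exists b; rewrite // !inE bB.
have A'1 : 1 \in A' by rewrite inE A1.
have B'1 : 1 \in B' by rewrite !inE B1 mulg1.
have [C [C1 sC gC]] := IHn _ _ ltB' A'1 B'1.
rewrite -card'; exists C; split=> //; apply: fsubset_trans sC _.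
apply/fsubsetP => _ /mulfP[x [y [+ + ->]]]; rewrite !inE.
move=> /orP[xA|/imfsetP[z /= zB ->]] /andP[yB eyA]; first exact: mem_mulf.
(* Here [e * z * y = (e * y) * z], where [e * y] is in [A] by definition of [B']. *)
by rewrite mulg_rotr mem_mulf.
Qed.

(** Translating by [a^-1] and [b^-1] puts [1] in both factors; translating back by [a * b] keeps
    sizes and stability. *)
Lemma kneser_bound_mem A B z : z \in mulf A B ->
  exists C, [/\ z \in C, C `<=` mulf A B & kneser_bound (#|` A| + #|` B|) C].
Proof.
case/mulfP=> a [b [aA bB ->]].
have mem1 x D : x \in D -> 1 \in lcosetf x^-1 D.
  by move=> xD; apply/imfsetP; exists x; rewrite ?mulVg.
have [C [C1 /fsubsetP sC [H [gH sH leH]]]] :=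
  kneser_bound_e_transform (mem1 _ _ aA) (mem1 _ _ bB).
exists (lcosetf (a * b) C); split.
- by apply/imfsetP; exists 1; rewrite ?mulg1.
- apply/fsubsetP => _ /imfsetP[c /= /sC/mulfP[u [v [uA vB ->]]] ->].
  have /imfsetP[x /= xA ->] := uA; have /imfsetP[y /= yB ->] := vB.
  suff -> : a * b * (a^-1 * x * (b^-1 * y)) = x * y by apply: mem_mulf.
  by rewrite (abG a b) -!mulgA mulVKg (abG x) -!mulgA mulVKg (abG y).
- exists H; split=> //; first exact: stable_lcosetf.
  by move: leH; rewrite !card_lcosetf.
Qed.

Theorem kneser_weak A B : A != fset0 -> B != fset0 ->
  kneser_bound (#|` A| + #|` B|) (mulf A B).
Proof.
move=> /fset0Pn[a aA] /fset0Pn[b bB].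
(* The sets around single elements are united along a list; the empty list starts from the one
   around [a * b]. *)
suff cover (s : seq G) : {subset s <= mulf A B} -> exists C,
    [/\ {subset s <= C}, C `<=` mulf A B & kneser_bound (#|` A| + #|` B|) C].
  have [//|C [sC1 sC2]] := cover (mulf A B).
  by suff -> : C = mulf A B by []; apply/eqP; rewrite eqEfsubset sC2; apply/fsubsetP.
elim: s => [_|z s IHs sub].
  by have [C [_ sC kC]] := kneser_bound_mem (mem_mulf aA bB); exists C.
have [C [zC sC kC]] := kneser_bound_mem (sub z (mem_head _ _)).
have [|D [sD sD' kD]] := IHs; first by move=> x xs; apply: sub; rewrite inE xs orbT.
exists (C `|` D); split; last exact: kneser_boundU.
- by move=> x; rewrite !inE => /predU1P[->|/sD->]; rewrite ?zC ?orbT.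
- by rewrite fsubUset sC.
Qed.

End Abelian.
End Kneser.

(** * Unmatchable pairs, and matchings from Hall and Kneser *)

Section Matchings.
Local Open Scope fset_scope.
Local Open Scope group_scope.
Variable G : groupType.
Implicit Types (A B H X Y : {fset G}).

Lemma lt_group_order_notin n X :
  lt_group_order n G -> (#|` X| <= n)%N -> exists x, x \notin X.
Proof.
move=> ltnG leXn; apply: contrapT => nX.
have eX : [set: G]%classic = [set` X]%classic.
  apply/seteqP; split=> // x _ /=.
  by apply: contrapT => /negP xX; apply: nX; exists x.
have := ltnG; rewrite /lt_group_order eX set_fsetK => /(_ (finite_fset X)).
by rewrite ltnNge leXn.
Qed.

(** Size [n.+1] is within reach because [n < |G|]; it leaves [n] elements once [1] is removed from a
    superset of [H]. *)
Lemma fsuperset_of_card n m X : lt_group_order n G -> (#|` X| <= m <= n.+1)%N ->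
  exists2 Y, X `<=` Y & #|` Y| = m.
Proof.
move=> ltnG /andP[]; elim: m => [|m IHm]; first by exists X => //; lia.
rewrite leq_eqVlt => /predU1P[<- _|leXm lemn]; first by exists X.
have [//||Y sXY cY] := IHm; first by lia.
have [|x xY] := lt_group_order_notin (X := Y) ltnG; first by rewrite cY.
exists (x |` Y); last by rewrite cardfsU1 xY cY.
exact: fsubset_trans sXY (fsubsetU1 _ _).
Qed.

Lemma fsubset_of_card m X : (m <= #|` X|)%N -> exists2 Y, Y `<=` X & #|` Y| = m.
Proof.
move=> leX; exists [fset x in take m X].
  by apply/fsubsetP => x; rewrite inE => /mem_take.
rewrite card_fseq undup_id ?size_takel //.
by rewrite take_uniq // fset_uniq.
Qed.

Lemma lcosetf_disjoint H A x : group_closed [in H] -> stable H A ->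
  x \notin A -> [disjoint lcosetf x H & A].
Proof.
move=> gH sA xA; apply/fdisjointP => _ /imfsetP[h /= hH ->].
by rewrite (stable_mulr _ gH).
Qed.

Lemma stable_of_card n H q : lt_group_order n G -> group_closed [in H] ->
  (q * #|` H| <= n)%N -> exists2 A, stable H A & #|` A| = (q * #|` H|)%N.
Proof.
move=> ltnG gH; elim: q => [|q IHq] leq; first by exists fset0.
have [|A sA cA] := IHq; first by apply: leq_trans leq; rewrite leq_mul2r leqnSn orbT.
have [|x xA] := lt_group_order_notin (X := A) ltnG.
  by rewrite cA; apply: leq_trans leq; rewrite leq_mul2r leqnSn orbT.
exists (lcosetf x H `|` A).
  by apply: stableU sA; apply/stable_lcosetf/group_closed_stable.
rewrite cardfsU card_lcosetf (eqP (lcosetf_disjoint gH sA xA)) cardfs0 cA.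
by rewrite subn0 mulSn.
Qed.

(* An element of [H] other than [1] moves an element of [A] out of [A] only if
   the latter lies in the incomplete coset, which is too small. *)
Lemma exists_unmatchable n H : lt_group_order n G -> group_closed [in H] ->
  (#|` H| <= n)%N -> ~~ (#|` H| %| n.+1)%N -> exists A B : {fset G},
  [/\ 1 \notin B, #|` A| = n, #|` B| = n & ~ matchable A B].
Proof.
move=> ltnG gH leHn ndvd; have H1 : 1 \in H by case: gH.
have H_gt0 : (0 < #|` H|)%N by rewrite cardfs_gt0; apply/fset0Pn; exists 1.
have [A0 sA0 cA0] := stable_of_card ltnG gH (leq_divM n #|` H|).
have [|x xA0] := lt_group_order_notin (X := A0) ltnG; first by rewrite cA0 leq_divM.
have [|R sR cR] := fsubset_of_card (m := n %% #|` H|) (X := lcosetf x H).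
  by rewrite card_lcosetf ltnW // ltn_pmod.
have [|Y sY cY] := fsuperset_of_card (m := n.+1) (X := H) ltnG.
  by rewrite leqnn andbT ltnW.
have dR : R `&` A0 = fset0.
  apply/eqP; rewrite -fsubset0 -(eqP (lcosetf_disjoint gH sA0 xA0)).
  exact: fsetSI.
exists (R `|` A0), (Y `\ 1); split.
- by rewrite !inE eqxx.
- by rewrite cardfsU dR cardfs0 cR cA0 subn0 addnC -divn_eq.
- by have := cardfsD1 1%g Y; rewrite cY (fsubsetP sY) // => -[].
case=> f [[g fK gK] fA].
(* [phi] extends the inverse of the matching to all of [G]; the default [1] is never reached on
   [H \ 1]. *)
pose phi b := if insub b is Some b' then val (g b') else 1.
have phiE b (bY : b \in Y `\ 1) : phi b = val (g [` bY]).
  by rewrite /phi insubT.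
have HY b : b \in H `\ 1 -> b \in Y `\ 1.
  by rewrite !inE => /andP[-> /(fsubsetP sY)].
have cphi : #|` [fset phi b | b in H `\ 1]| = #|` H `\ 1|.
  apply: card_in_imfset => b c /= /HY bY /HY cY'.
  by rewrite (phiE _ bY) (phiE _ cY') => /val_inj/(can_inj gK)/(congr1 val).
have : (#|` H `\ 1%g| <= n %% #|` H|)%N.
  rewrite -cphi -cR; apply/fsubset_leq_card/fsubsetP => _ /imfsetP[b /= bH ->].
  rewrite (phiE _ (HY _ bH)); set a := g _.
  have := fA a; rewrite /a gK -/a /=; have := valP a; rewrite !inE.
  case/orP=> // aA0; rewrite negb_or sA0 ?andbF //.
  by have := bH; rewrite !inE => /andP[].
(* The remainder is now at least [|H| - 1], hence equal to it, so [|H|] divides [n + 1]. *)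
have := cardfsD1 1%g H; rewrite H1 add1n => cH le; case/negP: ndvd.
have := ltn_pmod n H_gt0; have := divn_eq n #|` H| => en ltr.
have er : n %% #|` H| = #|` H|.-1.
  by apply/eqP; rewrite eqn_leq {3}cH le andbT -ltnS prednK.
by rewrite en er -addnS prednK // dvdn_addr ?dvdn_mull.
Qed.

Lemma matchable_of_dvd n A B : abelian_group G ->
  (forall H, group_closed [in H] -> (#|` H| <= n)%N -> (#|` H| %| n.+1)%N) ->
  1 \notin B -> #|` A| = n -> #|` B| = n -> matchable A B.
Proof.
move=> abG dvdH nB1 cA cB.
pose F (a : A) : {set B} := [set b | val a * val b \notin A].
suff /hall_marriage[f inj_f fF] :
    forall S : {set A}, #|S| <= #|(\bigcup_(x in S) F x)%SET|.
  exists f; split; last by move=> a; have := fF a; rewrite inE.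
  by apply: inj_card_bij inj_f _; rewrite -!cardfE cA cB.
move=> S; rewrite leqNgt; apply/negP; set N := (\bigcup_(x in S) F x)%SET => ltNS.
(* An element of [B] outside [N] sends all of [S] into [A], and so does [1]. As [|N| < |S|], the
   sizes of [S'] and [V] add up to at least [n + 2]. *)
pose S' := [fset val a | a in S]; pose V := 1 |` [fset val b | b in (~: N)%SET].
have cS : #|` S'| = #|S|.
  by rewrite card_imfset //= -?cardE //; apply: val_inj.
have cV : #|` V| = (n - #|N|).+1.
  rewrite cardfsU1 card_imfset /= -?cardE; last exact: val_inj.
  rewrite cardsCs setCK -cardfE cB.
  suff -> : 1 \notin [fset val b | b in (~: N)%SET] by [].
  by apply/imfsetP => -[b /= _ b1]; move: nB1; rewrite b1 (valP b).
have sSV : mulf S' V `<=` A.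
  apply/fsubsetP => _ /mulfP[_ [v [/imfsetP[a /= aS ->] + ->]]].
  rewrite !inE => /predU1P[->|/imfsetP[b /= bN ->]]; first by rewrite mulg1 (valP a).
  move: bN; rewrite inE; apply: contraNT => abA.
  by apply/bigcupP; exists a; rewrite // inE.
have S_gt0 : S' != fset0 by rewrite -cardfs_gt0 cS; lia.
have V_gt0 : V != fset0 by rewrite -cardfs_gt0 cV.
have [H [gH sH leH]] := kneser_weak abG S_gt0 V_gt0.
have leSV := fsubset_leq_card sSV; rewrite cA in leSV.
have [a aS] := fset0Pn _ S_gt0; have [v vV] := fset0Pn _ V_gt0.
(* The product contains a coset of [H], so [|H| <= n] and the divisibility hypothesis applies to
   [H]. *)
have leHSV := fsubset_leq_card (lcosetf_sub sH (mem_mulf aS vV)).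
rewrite card_lcosetf in leHSV.
have leHn := leq_trans leHSV leSV.
have /dvdnP[p ep] := dvdH _ gH leHn; have /dvdnP[q eq] := stable_dvd gH sH.
have ltqp : q < p.
  have : (q * #|` H| < p * #|` H|)%N by rewrite -ep -eq.
  by rewrite ltn_mul2r => /andP[].
have : (q.+1 * #|` H| <= p * #|` H|)%N by rewrite leq_mul2r ltqp orbT.
rewrite mulSn -ep -eq => leHn1.
have : (#|N| <= n)%N by rewrite -cB cardfE max_card.
by move: leH; rewrite cS cV; lia.
Qed.

End Matchings.

Theorem theorem2p8 (G : groupType) (abG : abelian_group G)
    (hG : has_finite_nontrivial_proper_subgroup G) (n : nat)
    (n0_le_n : (n0 hG <= n)%N) (n_lt_G : lt_group_order n G) :
  (exists A B : {fset G},
     [/\ (1%g : G) \notin B, #|` A|%fset = n, #|` B|%fset = n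
       & ~ matchable A B])
  <->
  (exists H : {fset G},
     [/\ group_closed [in H], (#|` H|%fset <= n)%N & ~~ (#|` H|%fset %| n.+1)%N]).
Proof.
split=> [[A [B [B1 cA cB nAB]]]|[H [gH leHn ndvd]]]; last first.
  exact: exists_unmatchable ndvd.
apply: contrapT => nH; apply: nAB; apply: matchable_of_dvd cA cB => // H gH leHn.
by apply: contrapT => /negP ndvd; apply: nH; exists H.
Qed.
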